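(* Let $s,t,p\ge 1$, $A,B\in GL(n)$ and $Q\in\mathcal{P}(n)$ with $k=\lambda_1(Q)>1$. Put $\tilde k=\lambda_n(Q)$, $q=\min\{t/s,p/s\}$ and $\tilde q=\max\{t/s,p/s\}$. If $$\|A\|^2+\|B\|^2<\frac{q^{\tilde q}\,\tilde k^{\tilde q+1}}{k^{\tilde q}(q+1)^{\tilde q+1}},$$ then the equation $X^s+A^*X^{-t}A+B^*X^{-p}B=Q$ has a Hermitian positive definite solution in $\big[\big(\tfrac{q\tilde k}{k(q+1)}\big)^{1/s}I,\;Q^{1/s}\big]$.
   Context: $GL(n)$: $n\times n$ complex nonsingular matrices; $\mathcal{P}(n)$: $n\times n$ Hermitian positive definite matrices. For Hermitian $M$, $\lambda_1(M)$ and $\lambda_n(M)$ are its largest and smallest eigenvalues. $\|\cdot\|$ is the spectral norm. For Hermitian $P,R$, $P\le R$ means $R-P$ is positive semidefinite, and $[P,R]=\{X \text{ Hermitian}: P\le X\le R\}$. Real powers of positive definite matrices are defined by functional calculus. *)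

(* Defs.v *)
From Stdlib Require Import Reals ClassicalEpsilon.
Open Scope R_scope.

Record C := mkC { re : R; im : R }.
Definition C0 : C := mkC 0 0.
Definition C1 : C := mkC 1 0.
Definition RtoC (x : R) : C := mkC x 0.
Definition Cadd (a b : C) : C := mkC (re a + re b) (im a + im b).
Definition Cmul (a b : C) : C :=
  mkC (re a * re b - im a * im b) (re a * im b + im a * re b).
Definition Cconj (a : C) : C := mkC (re a) (- im a).

(** n x n complex matrices, as functions on indices; only indices < n matter. *)
Definition Mat := nat -> nat -> C.
Definition Vec := nat -> C.

Fixpoint csum (f : nat -> C) (n : nat) : C :=
  match n with O => C0 | S m => Cadd (csum f m) (f m) end.

Definition mmul (n : nat) (A B : Mat) : Mat :=
  fun i j => csum (fun k => Cmul (A i k) (B k j)) n.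
Definition madd (A B : Mat) : Mat := fun i j => Cadd (A i j) (B i j).
Definition madj (A : Mat) : Mat := fun i j => Cconj (A j i).
Definition mscal (c : R) : Mat := fun i j => if Nat.eqb i j then RtoC c else C0.
Definition mid : Mat := mscal 1.
Definition mzero : Mat := fun _ _ => C0.
Definition mdiag (d : nat -> R) : Mat :=
  fun i j => if Nat.eqb i j then RtoC (d i) else C0.
Definition msub (A B : Mat) : Mat :=
  fun i j => Cadd (A i j) (Cmul (RtoC (-1)) (B i j)).

Definition mvmul (n : nat) (A : Mat) (v : Vec) : Vec :=
  fun i => csum (fun k => Cmul (A i k) (v k)) n.
Definition inner (n : nat) (u v : Vec) : C :=
  csum (fun i => Cmul (Cconj (u i)) (v i)) n.
Definition vnorm2 (n : nat) (v : Vec) : R := re (inner n v v).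

Definition meq (n : nat) (A B : Mat) : Prop :=
  forall i j, (i < n)%nat -> (j < n)%nat -> A i j = B i j.
Definition veq (n : nat) (u v : Vec) : Prop :=
  forall i, (i < n)%nat -> u i = v i.
Definition vnonzero (n : nat) (v : Vec) : Prop :=
  exists i, (i < n)%nat /\ v i <> C0.

Definition GL (n : nat) (A : Mat) : Prop :=
  exists Ai, meq n (mmul n A Ai) mid /\ meq n (mmul n Ai A) mid.

Definition Hermitian (n : nat) (M : Mat) : Prop := meq n (madj M) M.
Definition PSD (n : nat) (M : Mat) : Prop :=
  Hermitian n M /\ forall v, 0 <= re (inner n v (mvmul n M v)).
Definition PD (n : nat) (M : Mat) : Prop :=
  Hermitian n M /\ forall v, vnonzero n v -> 0 < re (inner n v (mvmul n M v)).
Definition Lle (n : nat) (P Q : Mat) : Prop := PSD n (msub Q P).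

Definition Unitary (n : nat) (U : Mat) : Prop := meq n (mmul n (madj U) U) mid.

Definition PowRel (n : nat) (X : Mat) (r : R) (Y : Mat) : Prop :=
  exists U d, Unitary n U /\ (forall i, (i < n)%nat -> 0 < d i) /\
    meq n X (mmul n (mmul n U (mdiag d)) (madj U)) /\
    meq n Y (mmul n (mmul n U (mdiag (fun i => Rpower (d i) r))) (madj U)).
Definition mpow (n : nat) (X : Mat) (r : R) : Mat :=
  epsilon (inhabits mzero) (fun Y => PowRel n X r Y).

Definition eigval (n : nat) (M : Mat) (mu : R) : Prop :=
  exists v, vnonzero n v /\ veq n (mvmul n M v) (fun i => Cmul (RtoC mu) (v i)).
Definition is_lmax (n : nat) (M : Mat) (k : R) : Prop :=
  eigval n M k /\ forall mu, eigval n M mu -> mu <= k.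
Definition is_lmin (n : nat) (M : Mat) (k : R) : Prop :=
  eigval n M k /\ forall mu, eigval n M mu -> k <= mu.

Definition is_opnorm (n : nat) (A : Mat) (a : R) : Prop :=
  is_lub (fun x => exists v, vnorm2 n v = 1 /\ x = sqrt (vnorm2 n (mvmul n A v))) a.

(* Main.v *)
(** With [Y = X^s] the equation reads [Y = F Y] for
    [F Y = Q - A^* Y^(-t/s) A - B^* Y^(-p/s) B]. Let [a = q kt / (k (q + 1))] and
    [g y = kt - |A|^2 y^(-t/s) - |B|^2 y^(-p/s)]. The norm condition gives
    [a < g a]; since [g] is concave, its first fixed point [b] beyond [a]
    satisfies [g' b < 1]. Now [F] maps [{Y >= b I}] to itself because
    [g b = b], and there [Y |-> Y^(-r)] has Lipschitz constant [r b^(-r-1)] for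
    the operator norm, as for scalars: for [r <= 1] this follows from the
    Loewner-Heinz inequality, and larger [r] are reached by the product rule.
    Hence [F] is a contraction with constant [g' b], and Banach's theorem
    gives [Y], which lies below [Q] since [F] does. Loewner-Heinz for the
    exponent [1 / s] then bounds [X = Y^(1/s)] by [Q^(1/s)]. *)

From HB Require Import structures.
Require Import Defs.
From Stdlib Require Import Reals Ranalysis5 Lra Lia ClassicalEpsilon.
Open Scope R_scope.

(** * Scalar estimates for negative powers *)

Lemma Rpower_opp_le (b x r : R) :
  0 < b -> b <= x -> 0 <= r -> Rpower x (- r) <= Rpower b (- r).
Proof.
intros Hb Hx Hr; rewrite !Rpower_Ropp.
apply Rinv_le_contravar; [apply exp_pos | apply Rle_Rpower_l; lra].
Qed.

Lemma derivable_pt_lim_Rpower_opp (r x : R) :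
  0 < x ->
  derivable_pt_lim (fun y => Rpower y (- r)) x (- (r * Rpower x (- (r + 1)))).
Proof.
intros Hx.
replace (- (r * Rpower x (- (r + 1)))) with (- r * Rpower x (- r - 1)).
  now apply derivable_pt_lim_power.
replace (- r - 1) with (- (r + 1)) by ring; ring.
Qed.

(** Mean value theorem: at any intermediate point beyond [b] the slope of [y^-r] is at most
    [r b^-(r+1)] in absolute value. *)
Lemma Rpower_opp_lipschitz (b x d r : R) :
  0 < b -> b <= x -> 0 <= d -> 0 <= r ->
  Rpower x (- r) - r * Rpower b (- (r + 1)) * d <= Rpower (x + d) (- r).
Proof.
intros Hb Hx Hd Hr.
destruct (Rle_lt_or_eq_dec _ _ Hd) as [Hd' | <-].
2: { rewrite Rplus_0_r; lra. }
destruct (MVT_cor2 (fun y => Rpower y (- r))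
  (fun y => - (r * Rpower y (- (r + 1)))) x (x + d)) as [c [Hc Hcx]]; [lra | |].
  intros c Hc; apply derivable_pt_lim_Rpower_opp; lra.
assert (H : Rpower c (- (r + 1)) <= Rpower b (- (r + 1)))
  by (apply Rpower_opp_le; lra).
assert (H' : r * Rpower c (- (r + 1)) * d <= r * Rpower b (- (r + 1)) * d)
  by (apply Rmult_le_compat_r; [lra|apply Rmult_le_compat_l; lra]).
simpl in Hc; replace (x + d - x) with d in Hc by ring; lra.
Qed.

(* The map g(y) = k - alpha y^-r1 - beta y^-r2 is concave, and g(a) > a. At the
   first fixed point b beyond a the chord from a to b has slope < 1, hence so
   has the tangent at b. *)
Lemma concave_fixed_point (k alpha beta r1 r2 a : R) :
  0 <= alpha -> 0 <= beta -> 0 < r1 -> 0 < r2 -> 0 < a ->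
  a < k - alpha * Rpower a (- r1) - beta * Rpower a (- r2) ->
  exists b, a <= b /\
    b = k - alpha * Rpower b (- r1) - beta * Rpower b (- r2) /\
    alpha * (r1 * Rpower b (- (r1 + 1))) + beta * (r2 * Rpower b (- (r2 + 1)))
      < 1.
Proof.
intros Hal Hbe Hr1 Hr2 Ha Hga.
set (g := fun y => k - alpha * Rpower y (- r1) - beta * Rpower y (- r2)).
set (g' := fun y => alpha * (r1 * Rpower y (- (r1 + 1)))
                    + beta * (r2 * Rpower y (- (r2 + 1)))).
assert (Dg : forall y, 0 < y -> derivable_pt_lim g y (g' y)).
{ intros y Hy; unfold g, g'.
  replace (alpha * (r1 * Rpower y (- (r1 + 1)))
           + beta * (r2 * Rpower y (- (r2 + 1)))) with
    (0 - alpha * (- (r1 * Rpower y (- (r1 + 1))))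
       - beta * (- (r2 * Rpower y (- (r2 + 1))))) by ring.
  apply derivable_pt_lim_minus; [apply derivable_pt_lim_minus|].
  - apply derivable_pt_lim_const.
  - apply derivable_pt_lim_scal, derivable_pt_lim_Rpower_opp; lra.
  - apply derivable_pt_lim_scal, derivable_pt_lim_Rpower_opp; lra. }
assert (Hgk : forall y, 0 < y -> g y <= k).
{ intros y Hy; unfold g.
  pose proof (Rmult_le_pos alpha (Rpower y (- r1)) Hal
                (Rlt_le _ _ (exp_pos _))).
  pose proof (Rmult_le_pos beta (Rpower y (- r2)) Hbe
                (Rlt_le _ _ (exp_pos _))).
  lra. }
assert (Hak : a < k) by (pose proof (Hgk a Ha); fold (g a) in Hga; lra).
assert (Hb : exists b, a <= b <= k /\ g b = b).
{ destruct (Rle_lt_or_eq_dec _ _ (Hgk k ltac:(lra))) as [Hlt|Heq].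
  2: { exists k; split; [lra | exact Heq]. }
  destruct (IVT_interv (fun y => y - g y) a k) as [b [Hb1 Hb2]].
  - intros y Hy; apply continuity_pt_minus.
      apply derivable_continuous_pt, derivable_pt_id.
    apply derivable_continuous_pt; exists (g' y); apply Dg; lra.
  - exact Hak.
  - fold (g a) in Hga; lra.
  - lra.
  - exists b; split; [exact Hb1 | lra]. }
destruct Hb as [b [Hb1 Hb2]].
exists b; split; [lra|]; split; [symmetry; exact Hb2|].
assert (Hab : a < b).
{ destruct (Rle_lt_or_eq_dec a b) as [|E]; [lra|lra|].
  fold (g a) in Hga; rewrite E in Hga; lra. }
destruct (MVT_cor2 g g' a b Hab) as [c [Hc1 Hc2]].
  intros c Hc; apply Dg; lra.
fold (g a) in Hga; fold (g' b).
assert (Hbc : g' b <= g' c).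
{ unfold g'; apply Rplus_le_compat; apply Rmult_le_compat_l; try lra;
  apply Rmult_le_compat_l; try lra; apply Rpower_opp_le; lra. }
destruct (Rlt_or_le (g' c) 1); [lra|].
pose proof (Rmult_le_compat_r (b - a) 1 (g' c) ltac:(lra) ltac:(lra)); lra.
Qed.

(** The right-hand side of the norm condition equals [a^qt * kt / (q + 1)]. Since [a < 1], both
    powers of [a] are at most [a^-qt], so the two subtracted terms sum to less than [kt / (q + 1)].
    What remains of [kt] exceeds [q kt / (q + 1) = a k], and [a k > a] because [k > 1]. *)
Lemma concave_start (k kt s t p alpha beta : R) :
  1 <= s -> 1 <= t -> 1 <= p -> 0 <= alpha -> 0 <= beta ->
  0 < kt -> kt <= k -> 1 < k ->
  let q := Rmin (t / s) (p / s) in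
  let qt := Rmax (t / s) (p / s) in
  let a := q * kt / (k * (q + 1)) in
  alpha + beta <
    Rpower q qt * Rpower kt (qt + 1) / (Rpower k qt * Rpower (q + 1) (qt + 1)) ->
  0 < a /\
  a < kt - alpha * Rpower a (- (t / s)) - beta * Rpower a (- (p / s)).
Proof.
intros Hs Ht Hp Hal Hbe Hkt Hktk Hk q qt a Hlt.
assert (Hts : 0 < t / s) by (apply Rdiv_lt_0_compat; lra).
assert (Hps : 0 < p / s) by (apply Rdiv_lt_0_compat; lra).
assert (Hq : 0 < q) by (unfold q; apply Rmin_glb_lt; lra).
assert (Hqt1 : t / s <= qt) by apply Rmax_l.
assert (Hqt2 : p / s <= qt) by apply Rmax_r.
assert (Hkq : 0 < k * (q + 1)) by (apply Rmult_lt_0_compat; lra).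
assert (Hb0 : 0 < q * kt / (q + 1)).
{ apply Rdiv_lt_0_compat; [apply Rmult_lt_0_compat|]; lra. }
assert (Ha : 0 < a).
{ apply Rdiv_lt_0_compat; [apply Rmult_lt_0_compat|]; lra. }
split; [exact Ha|].
assert (Hak : a * k = q * kt / (q + 1)) by (unfold a; field; lra).
assert (Ha1 : a < 1).
{ apply Rmult_lt_reg_r with (k * (q + 1)); [lra|].
  replace (a * (k * (q + 1))) with (q * kt) by (unfold a; field; lra).
  assert (q * kt <= q * k) by (apply Rmult_le_compat_l; lra). lra. }
assert (Hpow : forall r, r <= qt -> Rpower a (- r) <= Rpower a (- qt)).
{ intros r Hr; unfold Rpower.
  assert (Hln : ln a < 0) by (rewrite <- ln_1; apply ln_increasing; lra).
  destruct (Rle_lt_or_eq_dec _ _ Hr) as [H|E]; [|rewrite E; lra].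
  apply Rlt_le, exp_increasing.
  assert (0 < (r - qt) * ln a) by
    (replace ((r - qt) * ln a) with ((qt - r) * - ln a) by ring;
     apply Rmult_lt_0_compat; lra).
  lra. }
assert (HE : Rpower q qt * Rpower kt (qt + 1)
             / (Rpower k qt * Rpower (q + 1) (qt + 1))
           = Rpower a qt * (kt / (q + 1))).
{ assert (Hpa : Rpower a qt
      = Rpower q qt * Rpower kt qt / (Rpower k qt * Rpower (q + 1) qt)).
  { assert (E : Rpower (a * (k * (q + 1))) qt = Rpower (q * kt) qt)
      by (f_equal; unfold a; field; lra).
    rewrite <- !Rpower_mult_distr in E; try lra.
    assert (0 < Rpower k qt) by apply exp_pos.
    assert (0 < Rpower (q + 1) qt) by apply exp_pos.
    rewrite <- E; field; lra. }
  rewrite Hpa, !Rpower_plus, !Rpower_1; try lra.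
  assert (0 < Rpower k qt) by apply exp_pos.
  assert (0 < Rpower (q + 1) qt) by apply exp_pos.
  field; lra. }
rewrite HE in Hlt.
assert (Hpos : 0 < Rpower a (- qt)) by apply exp_pos.
assert (H1 : alpha * Rpower a (- (t / s)) <= alpha * Rpower a (- qt))
  by (apply Rmult_le_compat_l; auto).
assert (H2 : beta * Rpower a (- (p / s)) <= beta * Rpower a (- qt))
  by (apply Rmult_le_compat_l; auto).
assert (H3 : (alpha + beta) * Rpower a (- qt) < kt / (q + 1)).
{ apply Rmult_lt_compat_r with (r := Rpower a (- qt)) in Hlt; [|exact Hpos].
  replace (Rpower a qt * (kt / (q + 1)) * Rpower a (- qt))
    with (kt / (q + 1)) in Hlt; [exact Hlt|].
  rewrite Rpower_Ropp; field; split; [|lra].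
  apply Rgt_not_eq, exp_pos. }
assert (H4 : kt - kt / (q + 1) = a * k) by (rewrite Hak; field; lra).
assert (H5 : a * 1 < a * k) by (apply Rmult_lt_compat_l; lra).
lra.
Qed.

(** * Density, continuity and limits on the real line *)

(** Bisection keeps [r] between two points of [S] whose distance halves at each step. It serves to
    reach all exponents of the Loewner-Heinz inequality from midpoints. *)
Lemma midpoint_dense (S : R -> Prop) :
  S 0 -> S 1 -> (forall x y, S x -> S y -> S ((x + y) / 2)) ->
  forall r e, 0 <= r <= 1 -> 0 < e -> exists y, S y /\ Rabs (y - r) < e.
Proof.
intros S0 S1 Smid r e Hr He.
assert (H : forall N, exists l h,
    S l /\ S h /\ l <= r <= h /\ h - l <= (1 / 2) ^ N).
{ induction N as [|N [l [h [Sl [Sh [Hlh Hd]]]]]].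
  - exists 0, 1; simpl; repeat split; auto; lra.
  - destruct (Rle_lt_dec r ((l + h) / 2)).
    + exists l, ((l + h) / 2); simpl; repeat split; auto; lra.
    + exists ((l + h) / 2), h; simpl; repeat split; auto; lra. }
destruct (pow_lt_1_zero (1 / 2)) with (y := e) as [N HN]; auto.
  rewrite Rabs_right; lra.
destruct (H N) as [l [h [Sl [Sh [Hlh Hd]]]]].
exists l; split; [exact Sl|].
specialize (HN N (le_n N)); rewrite Rabs_right in HN.
  rewrite Rabs_left1; lra.
apply Rle_ge, pow_le; lra.
Qed.

Lemma continuity_adherent_ge0 (f : R -> R) (x : R) : continuity f ->
  (forall e, 0 < e -> exists y, 0 <= f y /\ Rabs (y - x) < e) -> 0 <= f x.
Proof.
intros Hf H; destruct (Rle_lt_dec 0 (f x)) as [|Hx]; [assumption|].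
destruct (Hf x (- f x)) as [e [He Hfe]]; [lra|].
destruct (H e He) as [y [Hy Hyx]].
(* The limit defining continuity excludes the point [x] itself, so [y = x] is a separate case. *)
destruct (Req_dec x y) as [->|Hne]; [assumption|].
assert (Hd : Rabs (f y - f x) < - f x).
{ apply Hfe; split; [split; [exact I | exact Hne] | exact Hyx]. }
revert Hd; unfold Rabs; destruct Rcase_abs; lra.
Qed.

Lemma continuity_Rpower_exponent (d c : R) : continuity (fun x => Rpower d x * c).
Proof. unfold Rpower; reg. Qed.

Lemma geometric_lt (k E e : R) : 0 < k < 1 -> 0 < E -> 0 < e ->
  exists N, forall m, (N <= m)%nat -> E * k ^ m < e.
Proof.
intros Hk HE He.
destruct (pow_lt_1_zero k) with (y := e / E) as [N HN].
- rewrite Rabs_right; lra.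
- apply Rdiv_lt_0_compat; lra.
- exists N; intros m Hm; specialize (HN m Hm).
  assert (0 < k ^ m) by (apply pow_lt; lra).
  rewrite Rabs_right in HN by lra.
  apply Rmult_lt_compat_l with (r := E) in HN; [|lra].
  replace (E * (e / E)) with e in HN by (field; lra); lra.
Qed.

Lemma geometric_cv (a : nat -> R) (k E : R) : 0 < k < 1 -> 0 < E ->
  (forall m l, Rabs (a (m + l)%nat - a m) <= E * k ^ m) -> exists L, Un_cv a L.
Proof.
intros Hk HE H; enough (Hc : Cauchy_crit a).
  destruct (R_complete a Hc) as [L HL]; now exists L.
(* Two terms beyond [N] are compared through [a N], each at distance below [e / 2]. *)
intros e He; destruct (geometric_lt k E (e / 2)) as [N HN]; try lra.
exists N; intros m l Hm Hl; unfold Rdist.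
pose proof (H N (m - N)%nat) as H1; pose proof (H N (l - N)%nat) as H2.
replace (N + (m - N))%nat with m in H1 by lia.
replace (N + (l - N))%nat with l in H2 by lia.
specialize (HN N (le_n N)); revert H1 H2.
unfold Rabs; repeat destruct Rcase_abs; lra.
Qed.

Lemma Un_cv_le_eventually (a : nat -> R) (L c : R) (N : nat) :
  Un_cv a L -> (forall m, (N <= m)%nat -> a m <= c) -> L <= c.
Proof.
intros Ha H; destruct (Rle_lt_dec L c) as [|Hlt]; [assumption|].
destruct (Ha (L - c)) as [N' HN']; [lra|].
specialize (HN' (N + N')%nat ltac:(lia)); specialize (H (N + N')%nat ltac:(lia)).
revert HN'; unfold Rdist, Rabs; destruct Rcase_abs; lra.
Qed.

Lemma Un_cv_const (c : R) : Un_cv (fun _ => c) c.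
Proof.
intros e He; exists 0%nat; intros m _; unfold Rdist.
replace (c - c) with 0 by ring; rewrite Rabs_R0; lra.
Qed.

From mathcomp Require Import all_boot all_order all_algebra.
From mathcomp Require Import complex Rstruct ring lra.
Set Implicit Arguments.
Unset Strict Implicit.
Unset Printing Implicit Defensive.
Import Order.TTheory GRing.Theory Num.Theory.
Local Open Scope ring_scope.
Local Open Scope sesquilinear_scope.

(** * The real inner product on complex vectors *)

(** Taking the real part makes the complex space a real inner product space, so that all estimates
    are inequalities between reals. *)
HB.lock Definition rdot (R : rcfType) (n : nat) (u v : 'cV[R[i]]_n) : R :=
  complex.Re ((u ^t* *m v) 0 0).

Section RealInnerProduct.
Variables (R : rcfType) (n : nat).
Implicit Types (u v w : 'cV[R[i]]_n) (M N : 'M[R[i]]_n).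

Lemma rdotE u v : rdot u v =
  \sum_i (complex.Re (u i 0) * complex.Re (v i 0)
          + complex.Im (u i 0) * complex.Im (v i 0)).
Proof.
rewrite rdot.unlock mxE (big_morph (@complex.Re R) (id1 := 0) (op1 := +%R)) //.
  by apply: eq_bigr => i _; rewrite !mxE; case: (u i 0); case: (v i 0) => a b c d /=;
     ring.
by case=> a b [].
Qed.

Lemma rdotC u v : rdot u v = rdot v u.
Proof. by rewrite !rdotE; apply: eq_bigr => i _; rewrite mulrC [X in _ + X]mulrC. Qed.

Lemma rdotDr u v w : rdot u (v + w) = rdot u v + rdot u w.
Proof.
rewrite !rdotE -big_split; apply: eq_bigr => i _; rewrite !mxE /=.
by case: (v i 0); case: (w i 0) => a b c d /=; ring.
Qed.

Lemma rdotZr (c : R) u v : rdot u (c%:C%C *: v) = c * rdot u v.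
Proof.
rewrite !rdotE mulr_sumr; apply: eq_bigr => i _; rewrite !mxE /=.
by case: (v i 0) => a b /=; ring.
Qed.

Lemma rdotNr u v : rdot u (- v) = - rdot u v.
Proof.
rewrite !rdotE -sumrN; apply: eq_bigr => i _; rewrite !mxE /=.
by case: (v i 0) => a b /=; ring.
Qed.

Lemma rdotNl u v : rdot (- u) v = - rdot u v.
Proof. by rewrite !(rdotC _ v) rdotNr. Qed.

Lemma rdotBr u v w : rdot u (v - w) = rdot u v - rdot u w.
Proof. by rewrite rdotDr rdotNr. Qed.

Lemma rdotDl u v w : rdot (v + w) u = rdot v u + rdot w u.
Proof. by rewrite !(rdotC _ u) rdotDr. Qed.

Lemma rdotZl (c : R) u v : rdot (c%:C%C *: u) v = c * rdot u v.
Proof. by rewrite !(rdotC _ v) rdotZr. Qed.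

Lemma rdot0r u : rdot u 0 = 0.
Proof. by rewrite -(subrr u) rdotBr subrr. Qed.

Definition rdot_lin := (rdotDl, rdotDr, rdotNl, rdotNr, rdotZl, rdotZr).

Lemma rdot_ge0 u : 0 <= rdot u u.
Proof. by rewrite rdotE sumr_ge0 // => i _; rewrite addr_ge0 // -expr2 sqr_ge0. Qed.

Lemma rdot_eq0 u : (rdot u u == 0) = (u == 0).
Proof.
apply/eqP/eqP => [|->]; last by rewrite rdotE big1 // => i _; rewrite !mxE /= mulr0 addr0.
rewrite rdotE => /eqP; rewrite psumr_eq0; last first.
  by move=> i _; rewrite addr_ge0 // -expr2 sqr_ge0.
move=> /allP h; apply/matrixP => i j; rewrite ord1 mxE.
have := h i (mem_index_enum _); rewrite /= -!expr2 paddr_eq0 ?sqr_ge0 //.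
by rewrite !sqrf_eq0; case: (u i 0) => a b /= /andP[/eqP-> /eqP->].
Qed.

Lemma rdot_gt0 u : u != 0 -> 0 < rdot u u.
Proof. by move=> u0; rewrite lt0r rdot_eq0 u0 rdot_ge0. Qed.

Lemma trmxC_mul (m k l : nat) (A : 'M[R[i]]_(m, k)) (B : 'M[R[i]]_(k, l)) :
  (A *m B) ^t* = B ^t* *m A ^t*.
Proof. by rewrite trmx_mul map_mxM. Qed.

Lemma rdot_adj M u v : rdot u (M *m v) = rdot (M ^t* *m u) v.
Proof. by rewrite rdot.unlock trmxC_mul trmxCK mulmxA. Qed.

Lemma rdot_herm M u v : M ^t* = M -> rdot u (M *m v) = rdot (M *m u) v.
Proof. by move=> h; rewrite rdot_adj h. Qed.

End RealInnerProduct.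

(* Abstracting the inner products first spares [lra] costly conversion tests
   between matrix expressions. *)
Ltac rdot_lra :=
  repeat match goal with |- context [rdot ?u ?v] => move: (rdot u v) end;
  intros; lra.

(** * Operator norm bounds and the Loewner order *)

Section OperatorBounds.
Variables (R : rcfType) (n : nat).
Implicit Types (u v w : 'cV[R[i]]_n) (A M N P S : 'M[R[i]]_n) (c d : R).

(* For [c >= 0] this says that the operator norm of [M] is at most [c]; it is
   linear in the pair [(M, c)] and avoids square roots. *)
Definition opb M (c : R) := forall u v,
  2 * rdot u (M *m v) <= c * (rdot u u + rdot v v).

Definition loewner_le M N := forall v, rdot v (M *m v) <= rdot v (N *m v).

Lemma opbD M N c d : opb M c -> opb N d -> opb (M + N) (c + d).
Proof.
move=> hM hN u v; rewrite mulmxDl rdotDr.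
by have := hM u v; have := hN u v; rdot_lra.
Qed.

Lemma opbN M c : opb M c -> opb (- M) c.
Proof.
by move=> hM u v; have := hM (- u) v; rewrite mulNmx !rdot_lin opprK.
Qed.

Lemma opbBC M N c : opb (M - N) c -> opb (N - M) c.
Proof. by move=> h; rewrite -opprB; apply: opbN. Qed.

Lemma opb_le M c d : c <= d -> opb M c -> opb M d.
Proof.
move=> cd hM u v; apply: le_trans (hM u v) _.
by rewrite ler_wpM2r // addr_ge0 ?rdot_ge0.
Qed.

(** Testing [opb] on [M v] and [c v] gives [2 c |M v|^2 <= c (|M v|^2 + c^2 |v|^2)]. *)
Lemma opb_norm M c : 0 < c -> opb M c ->
  forall v, rdot (M *m v) (M *m v) <= c ^+ 2 * rdot v v.
Proof.
move=> c0 hM v; have := hM (M *m v) (c%:C%C *: v).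
rewrite -scalemxAr !rdotZr rdotZl => h.
have {}h : c * (c ^+ 2 * rdot v v - rdot (M *m v) (M *m v)) >= 0 by nra.
by rewrite pmulr_rge0 // subr_ge0 in h.
Qed.

(** The bound for [M] is tested on [d u] and [N v]: as [|N v|^2 <= d^2 |v|^2], both squares acquire
    the factor [d^2], one [d] of which cancels. *)
Lemma opbM M N c d : 0 < c -> 0 < d -> opb M c -> opb N d -> opb (M *m N) (c * d).
Proof.
move=> c0 d0 hM hN u v; have := hM (d%:C%C *: u) (N *m v).
have := opb_norm d0 hN v; rewrite !rdotZl !rdotZr mulmxA => h1 h2.
suff : 0 <= d * (c * d * (rdot u u + rdot v v) - 2 * rdot u (M *m N *m v)).
  by rewrite pmulr_rge0 // subr_ge0.
have h3 : c * rdot (N *m v) (N *m v) <= c * (d ^+ 2 * rdot v v) by rewrite ler_pM2l.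
by move: h2 h3; rdot_lra.
Qed.

(** Here [a] bounds the squared norm of [A], which accounts for both outer factors at once. *)
Lemma opb_conj A M c a : 0 <= c ->
  (forall v, rdot (A *m v) (A *m v) <= a * rdot v v) ->
  opb M c -> opb (A ^t* *m M *m A) (a * c).
Proof.
move=> c0 hA hM u v; rewrite -!mulmxA rdot_adj trmxCK.
apply: le_trans (hM _ _) _; rewrite -mulrA mulrCA ler_wpM2l // mulrDr.
by rewrite lerD.
Qed.

(* Polarization: [4 <u, M v> = <u + v, M (u + v)> - <u - v, M (u - v)>]. *)
Lemma opb_loewner M c : M ^t* = M ->
  loewner_le M c%:C%C%:M -> loewner_le (- M) c%:C%C%:M -> opb M c.
Proof.
move=> hM h1 h2 u v; have := h1 (u + v); have := h2 (u - v).
rewrite !mul_scalar_mx !mulNmx !mulmxDr !mulmxN !rdot_lin.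
rewrite (rdot_herm v u hM) (rdotC (M *m v)) (rdotC v u). rdot_lra.
Qed.

Lemma loewner_opb M c : opb M c -> loewner_le M c%:C%C%:M.
Proof. by move=> h v; have := h v v; rewrite mul_scalar_mx rdotZr; rdot_lra. Qed.

Lemma loewnerB M N c :
  loewner_le (M - N) c%:C%C%:M <-> loewner_le M (N + c%:C%C%:M).
Proof.
by split=> h v; have := h v; rewrite mulmxBl mulmxDl rdotBr rdotDr; rdot_lra.
Qed.

Lemma opb_psd M c : M ^t* = M -> loewner_le 0 M -> loewner_le M c%:C%C%:M -> opb M c.
Proof.
move=> hM h0 hc; apply: opb_loewner => // v; apply: le_trans (hc v).
by have := h0 v; rewrite mul0mx mulNmx rdotNr rdot0r; rdot_lra.
Qed.

Lemma opb_eq0 M : (forall e, 0 < e -> opb M e) -> M = 0.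
Proof.
move=> h; have Mv v : M *m v = 0.
  apply/eqP; rewrite -rdot_eq0 eq_le rdot_ge0 andbT; apply/ler_addgt0Pl => e e0.
  rewrite addr0; set w := M *m v.
  (* The tolerance used is [e] divided by this sum; the [+ 1] keeps the divisor positive when
     [v = 0]. *)
  have S0 : 0 < rdot w w + rdot v v + 1.
    by have := rdot_ge0 w; have := rdot_ge0 v; rdot_lra.
  have := h _ (divr_gt0 e0 S0) w v; rewrite -/w.
  have : e / (rdot w w + rdot v v + 1) * (rdot w w + rdot v v) <= e.
    by rewrite mulrAC ler_pdivrMr // ler_pM2l //; rdot_lra.
  by rdot_lra.
apply/matrixP => i j; rewrite mxE; have := Mv (delta_mx j 0).
by rewrite -colE => /matrixP /(_ i 0); rewrite !mxE.
Qed.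

(** Completing the square: expand [0 <= <x, P x>] at [x = S' v - P' v], and bound [<S' v, P S' v>]
    by [<S' v, S S' v> = <S' v, v>]. *)
Lemma loewner_le_inv P P' S S' : P ^t* = P -> loewner_le 0 P ->
  P *m P' = 1%:M -> S *m S' = 1%:M ->
  loewner_le P S -> loewner_le S' P'.
Proof.
move=> hP P0 PP' SS' PS v.
have := P0 (S' *m v - P' *m v); have := PS (S' *m v).
rewrite mul0mx rdot0r (mulmxA S) SS' mul1mx mulmxBr (mulmxA P P') PP' mul1mx.
rewrite !rdot_lin (rdot_herm (P' *m v) _ hP) (mulmxA P P') PP' mul1mx.
by rewrite (rdotC (S' *m v) v) (rdotC (P' *m v) v); rdot_lra.
Qed.
End OperatorBounds.

(** * Unitary diagonalization and functional calculus *)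

Section UnitaryConjugation.
Variables (C : numClosedFieldType) (n : nat).
Implicit Types U V D E : 'M[C]_n.

Lemma unitarymxK U : U \is unitarymx -> U ^t* *m U = 1%:M.
Proof. by rewrite -trmxC_unitary => /unitarymxP; rewrite trmxCK. Qed.

(** Equality of two diagonalizations becomes an intertwining relation for [V^* U], which can be
    compared entry by entry. *)
Lemma unitary_conj_eq U V D E : U \is unitarymx -> V \is unitarymx ->
  (U *m D *m U ^t* = V *m E *m V ^t*) <-> (V ^t* *m U *m D = E *m (V ^t* *m U)).
Proof.
move=> hU hV; split=> [h|h].
  have := congr1 (fun X => V ^t* *m X *m U) h; rewrite !mulmxA.
  rewrite -(mulmxA _ (U ^t*) U) (unitarymxK hU) mulmx1 => ->.
  by rewrite (unitarymxK hV) mul1mx.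
have := congr1 (fun X => V *m X *m U ^t*) h; rewrite !mulmxA (unitarymxP hV) mul1mx => ->.
by rewrite -(mulmxA _ U) (unitarymxP hU) mulmx1.
Qed.

Lemma unitary_conj_herm U D : D ^t* = D -> (U *m D *m U ^t*) ^t* = U *m D *m U ^t*.
Proof.
by move=> hD; rewrite trmx_mul map_mxM trmx_mul map_mxM trmxCK hD mulmxA.
Qed.

Lemma unitary_conjM U D E : U \is unitarymx ->
  (U *m D *m U ^t*) *m (U *m E *m U ^t*) = U *m (D *m E) *m U ^t*.
Proof.
by move=> hU; rewrite !mulmxA -(mulmxA _ (U ^t*) U) unitarymxK // mulmx1.
Qed.
End UnitaryConjugation.

HB.lock Definition spec_mx (R : rcfType) (n : nat) (U : 'M[R[i]]_n)
  (d : 'I_n -> R) : 'M[R[i]]_n := U *m diag_mx (\row_i (d i)%:C%C) *m U ^t*.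

Section FunctionalCalculus.
Variables (R : rcfType) (n : nat).
Implicit Types (v : 'cV[R[i]]_n) (M U V : 'M[R[i]]_n) (d e : 'I_n -> R).

(** [spectralmx M] diagonalizes in the form [V^* D V], so its adjoint takes the place of [U]. *)
Definition fcalc (f : R -> R) M : 'M[R[i]]_n :=
  spec_mx ((spectralmx M) ^t*) (fun i => f (complex.Re (spectral_diag M 0 i))).

Lemma eq_spec_mx U d e : d =1 e -> spec_mx U d = spec_mx U e.
Proof.
move=> de; rewrite spec_mx.unlock; congr (_ *m diag_mx _ *m _).
by apply/rowP => i; rewrite !mxE de.
Qed.

Lemma spec_mx_spectral M : M ^t* = M ->
  M = spec_mx ((spectralmx M) ^t*) (fun i => complex.Re (spectral_diag M 0 i)).
Proof.
move=> hM.
have hH : M \is hermsymmx by apply/is_hermitianmxP; rewrite expr0 scale1r hM.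
rewrite {1}(orthomx_spectralP (hermitian_normalmx hH)).
rewrite invmx_unitary ?spectral_unitarymx // spec_mx.unlock trmxCK.
congr (_ *m diag_mx _ *m _); apply/rowP => i; rewrite !mxE.
have /mxOverP /(_ 0 i) := hermitian_spectral_diag_real hH.
by move=> /RRe_real ->.
Qed.

Lemma spec_mxP M : M ^t* = M ->
  exists U d, U \is unitarymx /\ M = spec_mx U d.
Proof.
move=> /spec_mx_spectral E.
exists ((spectralmx M) ^t*), (fun i => complex.Re (spectral_diag M 0 i)).
by rewrite trmxC_unitary spectral_unitarymx.
Qed.

Lemma spec_mx_herm U d : (spec_mx U d) ^t* = spec_mx U d.
Proof.
rewrite spec_mx.unlock; apply: unitary_conj_herm.
rewrite tr_diag_mx map_diag_mx; congr diag_mx; apply/rowP => i.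
by rewrite !mxE; apply: conjc_real.
Qed.

Lemma diag_intertwine (f : R -> R) (W : 'M[R[i]]_n) d e :
  W *m diag_mx (\row_i (d i)%:C%C) = diag_mx (\row_i (e i)%:C%C) *m W ->
  W *m diag_mx (\row_i (f (d i))%:C%C) = diag_mx (\row_i (f (e i))%:C%C) *m W.
Proof.
move=> WE; apply/matrixP => i j; move/matrixP/(_ i j): WE.
rewrite !mul_mx_diag !mul_diag_mx !mxE ![W i j * _]mulrC.
have [->|W0] := eqVneq (W i j) 0; first by rewrite !mulr0.
by move=> /(mulIf W0) /complexI ->.
Qed.

(* The unitary [W = V^* U] intertwines the two diagonals, so [W i j != 0]
   forces [e i = d j]; hence [W] also intertwines their images under [f]. *)
Lemma spec_mx_comp (f : R -> R) U V d e :
  U \is unitarymx -> V \is unitarymx -> spec_mx U d = spec_mx V e ->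
  spec_mx U (fun i => f (d i)) = spec_mx V (fun i => f (e i)).
Proof.
move=> hU hV; rewrite spec_mx.unlock => /(unitary_conj_eq _ _ hU hV) UV.
exact/(unitary_conj_eq _ _ hU hV)/diag_intertwine.
Qed.

(** Independence of the chosen diagonalization: any other one computes the same value, by
    [spec_mx_comp]. *)
Lemma fcalc_spec f U d : U \is unitarymx ->
  fcalc f (spec_mx U d) = spec_mx U (fun i => f (d i)).
Proof.
move=> hU; set M := spec_mx U d.
have hV : (spectralmx M) ^t* \is unitarymx.
  by rewrite trmxC_unitary spectral_unitarymx.
by have /(spec_mx_comp f hU hV) := spec_mx_spectral (spec_mx_herm U d).
Qed.

Lemma spec_mxM U d e : U \is unitarymx ->
  spec_mx U d *m spec_mx U e = spec_mx U (fun i => d i * e i).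
Proof.
move=> hU; rewrite spec_mx.unlock; apply: etrans (unitary_conjM _ _ hU) _.
rewrite mulmx_diag; congr (_ *m diag_mx _ *m _).
by apply/rowP => i; rewrite !mxE -rmorphM.
Qed.

Lemma spec_mxD U d e : spec_mx U d + spec_mx U e = spec_mx U (fun i => d i + e i).
Proof.
rewrite spec_mx.unlock -mulmxDl -mulmxDr -linearD /=; congr (_ *m diag_mx _ *m _).
by apply/rowP => i; rewrite !mxE -rmorphD.
Qed.

Lemma spec_mx_const U (c : R) : U \is unitarymx -> spec_mx U (fun=> c) = c%:C%C%:M.
Proof.
move=> hU; rewrite spec_mx.unlock.
have -> : \row_i c%:C%C = const_mx c%:C%C :> 'rV[R[i]]_n by apply/rowP => i; rewrite !mxE.
by rewrite diag_const_mx scalar_mxC -mulmxA (unitarymxP hU) mulmx1.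
Qed.

Lemma spec_mx_rdot U d v : rdot v (spec_mx U d *m v) =
  \sum_i d i * (complex.Re ((U ^t* *m v) i 0) ^+ 2
                + complex.Im ((U ^t* *m v) i 0) ^+ 2).
Proof.
rewrite spec_mx.unlock -!mulmxA rdot_adj rdotE; apply: eq_bigr => i _.
move: (U ^t* *m v) => w; rewrite mul_diag_mx !mxE.
by case: (w i 0) => a b /=; ring.
Qed.

Lemma spec_mx_le U d e : (forall i, d i <= e i) -> loewner_le (spec_mx U d) (spec_mx U e).
Proof.
move=> de v; rewrite !spec_mx_rdot; apply: ler_sum => i _.
by rewrite ler_wpM2r // addr_ge0 // sqr_ge0.
Qed.

Lemma spec_mx_col U d i : U \is unitarymx ->
  spec_mx U d *m col i U = (d i)%:C%C *: col i U.
Proof.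
move=> hU; rewrite spec_mx.unlock colE !mulmxA -(mulmxA _ (U ^t*)) unitarymxK // mulmx1.
rewrite -!mulmxA -colE scalemxAr; congr (_ *m _); apply/colP => j.
by rewrite !mxE andbT; have [->|] := eqVneq j i; rewrite ?mulr1n ?mulr1 // mulr0n mulr0.
Qed.

Lemma rdot_col_unitary U i : U \is unitarymx -> rdot (col i U) (col i U) = 1.
Proof.
move=> /unitarymxK /matrixP /(_ i i); rewrite rdot.unlock.
rewrite !mxE eqxx => E.
have -> : \sum_j (col i U) ^t* 0 j * col i U j 0 = 1 :> R[i]; last by [].
by rewrite -[RHS]E; apply: eq_bigr => j _; rewrite !mxE.
Qed.

Lemma spec_mx_le_inv U d (c : R) i : U \is unitarymx ->
  loewner_le c%:C%C%:M (spec_mx U d) -> c <= d i.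
Proof.
move=> hU /(_ (col i U)).
by rewrite spec_mx_col // mul_scalar_mx !rdotZr rdot_col_unitary // !mulr1.
Qed.
End FunctionalCalculus.

#[local] Bind Scope ring_scope with R.
#[local] Arguments Rpower (_ _)%_ring_scope.

(** * Real powers and the Loewner-Heinz inequality *)

HB.lock Definition mxpow (n : nat) (M : 'M[R[i]]_n) (r : R) : 'M[R[i]]_n :=
  fcalc (fun x => Rpower x r) M.

Section RealPowers.
Variable n : nat.
Local Notation MC := 'M[R[i]]_n.
Implicit Types (A B M X Y Z : MC) (r u b c : R).

(** Positive definiteness in spectral form, the form in which powers are computed; [PD_posdef]
    derives it from [PD]. *)
Definition posdef M :=
  exists U d, [/\ U \is unitarymx, forall i, 0 < d i & M = spec_mx U d].

Lemma posdef_herm M : posdef M -> M ^t* = M.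
Proof. by move=> [U [d [_ _ ->]]]; rewrite spec_mx_herm. Qed.

Lemma mxpow_spec (U : MC) d r : U \is unitarymx ->
  mxpow (spec_mx U d) r = spec_mx U (fun i => Rpower (d i) r).
Proof. by move=> hU; rewrite mxpow.unlock fcalc_spec. Qed.

Lemma mxpow_herm M r : (mxpow M r) ^t* = mxpow M r.
Proof. by rewrite mxpow.unlock spec_mx_herm. Qed.

Lemma Rpower_gt0 (x r : R) : 0 < Rpower x r.
Proof. by apply/RltP; apply: exp_pos. Qed.

Lemma mxpow_posdef M r : posdef M -> posdef (mxpow M r).
Proof.
move=> [U [d [hU d0 ->]]]; exists U, (fun i => Rpower (d i) r); split=> //.
  by move=> i; apply: Rpower_gt0.
by rewrite mxpow_spec.
Qed.

Lemma mxpowD M r u : posdef M -> mxpow M (r + u) = mxpow M r *m mxpow M u.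
Proof.
move=> [U [d [hU d0 ->]]]; rewrite !mxpow_spec // spec_mxM //.
by apply: eq_spec_mx => i; rewrite Rpower_plus.
Qed.

Lemma mxpow0 M : posdef M -> mxpow M 0 = 1%:M.
Proof.
move=> [U [d [hU d0 ->]]]; rewrite mxpow_spec // -(spec_mx_const 1 hU).
by apply: eq_spec_mx => i; apply: Rpower_O; apply/RltP.
Qed.

Lemma mxpow1 M : posdef M -> mxpow M 1 = M.
Proof.
move=> [U [d [hU d0 ->]]]; rewrite mxpow_spec //.
by apply: eq_spec_mx => i; apply: Rpower_1; apply/RltP.
Qed.

Lemma mxpowM M r u : posdef M -> mxpow (mxpow M r) u = mxpow M (r * u).
Proof.
move=> [U [d [hU d0 ->]]]; rewrite !mxpow_spec //.
by apply: eq_spec_mx => i; rewrite Rpower_mult.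
Qed.

(** [Rpower] is an exponential, hence positive at every real argument, whatever the spectrum of
    [M]. *)
Lemma mxpow_ge0 M r : loewner_le 0 (mxpow M r).
Proof.
move=> v; rewrite mul0mx rdot0r mxpow.unlock spec_mx_rdot sumr_ge0 // => i _.
by apply: mulr_ge0; [exact/ltW/Rpower_gt0 | rewrite addr_ge0 ?sqr_ge0].
Qed.

Lemma spec_mx_geP M b : M ^t* = M -> loewner_le b%:C%C%:M M ->
  exists U d, [/\ U \is unitarymx, forall i, b <= d i & M = spec_mx U d].
Proof.
move=> /spec_mxP [U [d [hU ->]]] h; exists U, d; split=> // i.
exact: spec_mx_le_inv h.
Qed.

Lemma ge_posdef M b : 0 < b -> M ^t* = M -> loewner_le b%:C%C%:M M -> posdef M.
Proof.
move=> b0 hM /(spec_mx_geP hM) [U [d [hU bd ->]]]; exists U, d; split=> // i.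
exact: lt_le_trans (bd i).
Qed.

Lemma mxpow_mulV M r : posdef M -> mxpow M r *m mxpow M (- r) = 1%:M.
Proof. by move=> hM; rewrite -mxpowD // subrr mxpow0. Qed.

Lemma mxpow_mulA M r u (v : 'cV_n) : posdef M ->
  mxpow M r *m (mxpow M u *m v) = mxpow M (r + u) *m v.
Proof. by move=> hM; rewrite mulmxA mxpowD. Qed.

Lemma rdot_mxpow M r v w : rdot (mxpow M r *m v) w = rdot v (mxpow M r *m w).
Proof. by rewrite rdot_adj mxpow_herm. Qed.

Lemma mxpow_sqr M r v : posdef M ->
  rdot v (mxpow M r *m v) = rdot (mxpow M (r / 2) *m v) (mxpow M (r / 2) *m v).
Proof.
move=> hM; rewrite rdot_mxpow mxpow_mulA //.
by congr (rdot _ (mxpow _ _ *m _)); lra.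
Qed.

(* Pedersen's argument: an eigenvalue [l] of [A^(-m/2) B^m A^(-m/2)] satisfies
   [B^m x = l A^m x] for some [x != 0]; pairing this with [A^((u-r)/2) x] and
   using the two hypotheses gives [l <x, A^u x> <= <x, A^u x>]. *)
Lemma mxpow_le_midpoint A B r u : posdef A -> posdef B ->
  loewner_le (mxpow B r) (mxpow A r) -> loewner_le (mxpow B u) (mxpow A u) ->
  loewner_le (mxpow B ((r + u) / 2)) (mxpow A ((r + u) / 2)).
Proof.
move=> hA hB hr hu; set m := (r + u) / 2.
pose T := mxpow A (- (m / 2)) *m mxpow B m *m mxpow A (- (m / 2)).
have hT : T ^t* = T by rewrite /T !trmxC_mul !mxpow_herm mulmxA.
have [W [f [hW TE]]] := spec_mxP hT.
have f1 i : f i <= 1.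
  pose w := col i W; pose x := mxpow A (- (m / 2)) *m w.
  have wE : w = mxpow A (m / 2) *m x.
    by rewrite /x mxpow_mulA // subrr mxpow0 // mul1mx.
  have Tw : mxpow B m *m x = (f i)%:C%C *: (mxpow A m *m x).
    have := congr1 (mulmx (mxpow A (m / 2))) (spec_mx_col f i hW).
    rewrite -TE /T !mulmxA mxpow_mulV // mul1mx -scalemxAr -!mulmxA -/w -/x => ->.
    by rewrite wE mxpow_mulA //; congr (_ *: (mxpow _ _ *m _)); lra.
  pose p := mxpow A ((u - r) / 2) *m x.
  have Apos : 0 < rdot x (mxpow A u *m x).
    rewrite mxpow_sqr //; apply: rdot_gt0; apply/eqP => x0.
    have w0 : w = 0.
      rewrite wE; have -> : m / 2 = (m / 2 - u / 2) + u / 2 by lra.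
      by rewrite mxpowD // -mulmxA x0 mulmx0.
    have := rdot_col_unitary i hW; rewrite -/w w0 rdot0r => /eqP.
    by rewrite eq_sym oner_eq0.
  have E1 : rdot p (mxpow B m *m x) = f i * rdot x (mxpow A u *m x).
    rewrite Tw rdotZr /p rdot_mxpow mxpow_mulA //.
    by congr (_ * rdot _ (mxpow _ _ *m _)); rewrite /m; lra.
  have E2 : rdot p (mxpow A r *m p) = rdot x (mxpow A u *m x).
    rewrite /p rdot_mxpow !mxpow_mulA //.
    by congr (rdot _ (mxpow _ _ *m _)); lra.
  have E3 : rdot p (mxpow B m *m x)
            = rdot (mxpow B (r / 2) *m p) (mxpow B (u / 2) *m x).
    rewrite (rdot_mxpow B) mxpow_mulA //.
    by congr (rdot _ (mxpow _ _ *m _)); rewrite /m; lra.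
  clearbody p; have E4 := hr p; have E5 := hu x; rewrite !(mxpow_sqr _ _ hB) in E4 E5.
  (* [2 <y, z> <= |y|^2 + |z|^2] for [y = B^(r/2) p] and [z = B^(u/2) x]; by [E4], [E5] and [E2]
     each square is at most [<x, A^u x>]. *)
  have := rdot_ge0 (mxpow B (r / 2) *m p - mxpow B (u / 2) *m x).
  rewrite !rdot_lin (rdotC (mxpow B (u / 2) *m x) (mxpow B (r / 2) *m p)) -E3 E1.
  move: E4 E5; rewrite E2 => E4 E5 E6.
  suff : f i * rdot x (mxpow A u *m x) <= 1 * rdot x (mxpow A u *m x).
    by rewrite ler_pM2r.
  by move: E4 E5 E6; rewrite mul1r; rdot_lra.
(* All eigenvalues of [T] are at most 1; testing this on [A^(m/2) v] cancels the outer factors of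
   [T]. *)
move=> v; pose y := mxpow A (m / 2) *m v.
have : rdot y (T *m y) <= rdot y y.
  have := spec_mx_le W f1 y.
  by rewrite -TE (spec_mx_const _ hW) mul_scalar_mx scale1r.
have -> : T *m y = mxpow A (- (m / 2)) *m (mxpow B m *m v).
  by rewrite /T /y -!mulmxA mxpow_mulA // addNr mxpow0 // mul1mx.
by rewrite -mxpow_sqr // /y rdot_mxpow mxpow_mulA // subrr mxpow0 // mul1mx.
Qed.

Lemma continuity_rdot_mxpow M v : posdef M ->
  continuity (fun x => rdot v (mxpow M x *m v)).
Proof.
move=> [U [d [hU d0 ->]]].
apply: (continuity_eq (f := fun x => \sum_i Rpower (d i) x *
   (complex.Re ((U ^t* *m v) i 0) ^+ 2 + complex.Im ((U ^t* *m v) i 0) ^+ 2))).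
  by move=> x; rewrite mxpow_spec // spec_mx_rdot.
by apply: continuity_sum => i _; apply: continuity_Rpower_exponent.
Qed.

(** The exponents for which the order is preserved contain 0 and 1 and are closed under midpoints,
    hence are dense in [[0, 1]]. For fixed [v] the two quadratic forms are continuous in the
    exponent. *)
Theorem loewner_heinz A B r : posdef A -> posdef B -> loewner_le B A ->
  0 <= r <= 1 -> loewner_le (mxpow B r) (mxpow A r).
Proof.
move=> hA hB hBA /andP[/RleP r0 /RleP r1] v.
pose S x := loewner_le (mxpow B x) (mxpow A x).
rewrite -subr_ge0; apply/RleP.
pose g x := Rminus (rdot v (mxpow A x *m v)) (rdot v (mxpow B x *m v)).
apply: (@continuity_adherent_ge0 g r).
  by apply: continuity_minus; apply: continuity_rdot_mxpow.
move=> e e0; have [||x y Sx Sy|y [Sy ye]] := @midpoint_dense S _ _ _ r e (conj r0 r1) e0.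
- by rewrite /S !mxpow0.
- by rewrite /S !mxpow1.
- exact: mxpow_le_midpoint.
by exists y; split=> //; apply/RleP; rewrite /g RminusE subr_ge0; apply: Sy.
Qed.
End RealPowers.

(** * Lipschitz bounds for negative matrix powers *)

Section PowerLipschitz.
Variables (n : nat) (b : R).
Hypothesis b_gt0 : 0 < b.
Implicit Types (M Y Z : 'M[R[i]]_n) (r c : R).

(** The Hermitian matrices with spectrum in [[b, oo)], the set on which the contraction acts. *)
Definition ge_scalar M := M ^t* = M /\ loewner_le b%:C%C%:M M.

Lemma ge_scalarP M : ge_scalar M ->
  exists U d, [/\ U \is unitarymx, forall i, b <= d i & M = spec_mx U d].
Proof. by case=> hM bM; apply: spec_mx_geP. Qed.

Lemma ge_scalar_posdef M : ge_scalar M -> posdef M.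
Proof. by case; apply: ge_posdef. Qed.

Lemma ge_scalar_mxpow_opp M r : 0 <= r -> ge_scalar M ->
  loewner_le (mxpow M (- r)) (Rpower b (- r))%:C%C%:M.
Proof.
move=> r0 /ge_scalarP [U [d [hU bd ->]]]; rewrite mxpow_spec // -(spec_mx_const _ hU).
apply: spec_mx_le => i; apply/RleP; apply: Rpower_opp_le; exact/RleP || exact/RltP.
Qed.

Lemma ge_scalar_mxpow M r : 0 <= r -> ge_scalar M ->
  loewner_le (Rpower b r)%:C%C%:M (mxpow M r).
Proof.
move=> r0 /ge_scalarP [U [d [hU bd ->]]]; rewrite mxpow_spec // -(spec_mx_const _ hU).
apply: spec_mx_le => i; apply/RleP; apply: Rle_Rpower_l; first exact/RleP.
by split; [exact/RltP | exact/RleP].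
Qed.

Lemma opb_mxpow_opp M r : 0 <= r -> ge_scalar M -> opb (mxpow M (- r)) (Rpower b (- r)).
Proof.
move=> r0 hM; apply: opb_psd; first exact: mxpow_herm.
  exact: mxpow_ge0.
exact: ge_scalar_mxpow_opp.
Qed.

(** For [r > 0], the largest absolute slope of [y^-r] on [[b, oo)], attained at [b]. *)
Let lip r := r * Rpower b (- (r + 1)).

(* [Y <= Z + c] gives [(Z + c)^-r <= Y^-r] by Loewner-Heinz, and
   [Z^-r <= (Z + c)^-r + lip r * c] is a statement about the spectrum of [Z]. *)
Lemma mxpow_opp_lip_le1_half r Y Z c : 0 < r <= 1 -> 0 <= c ->
  ge_scalar Y -> ge_scalar Z -> loewner_le Y (Z + c%:C%C%:M) ->
  loewner_le (mxpow Z (- r) - mxpow Y (- r)) (lip r * c)%:C%C%:M.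
Proof.
move=> /andP[r0 r1] c0 hY hZ YZ; apply/loewnerB.
have [U [d [hU bd ZE]]] := ge_scalarP hZ.
pose Z' := spec_mx U (fun i => d i + c).
have hZ' : posdef Z'.
  exists U, (fun i => d i + c); split=> // i.
  by rewrite (lt_le_trans b_gt0) // (le_trans (bd i)) // lerDl.
have Z'E : Z + c%:C%C%:M = Z' by rewrite ZE -(spec_mx_const _ hU) spec_mxD.
have pY := ge_scalar_posdef hY.
have h1 : loewner_le (mxpow Z' (- r)) (mxpow Y (- r)).
  apply: (loewner_le_inv (P := mxpow Y r) (S := mxpow Z' r)).
  - exact: mxpow_herm.
  - exact: mxpow_ge0.
  - exact: mxpow_mulV.
  - exact: mxpow_mulV.
  - by apply: loewner_heinz => //; [rewrite -Z'E | rewrite ltW].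
have h2 : loewner_le (mxpow Z (- r)) (mxpow Z' (- r) + (lip r * c)%:C%C%:M).
  rewrite ZE /Z' !mxpow_spec // -(spec_mx_const _ hU) spec_mxD.
  apply: spec_mx_le => i; rewrite -lerBlDr; apply/RleP.
  by apply: Rpower_opp_lipschitz; exact/RleP || exact/RltP || exact/RleP/ltW.
move=> v; apply: le_trans (h2 v) _.
by rewrite !mulmxDl !rdotDr lerD2r.
Qed.

Lemma mxpow_opp_lip_le1 r Y Z c : 0 < r <= 1 -> 0 <= c ->
  ge_scalar Y -> ge_scalar Z -> opb (Y - Z) c ->
  opb (mxpow Y (- r) - mxpow Z (- r)) (lip r * c).
Proof.
move=> hr c0 hY hZ hYZ; apply: opb_loewner.
- by rewrite linearB /= map_mxB !mxpow_herm.
- by apply: mxpow_opp_lip_le1_half => //; apply/loewnerB/loewner_opb/opbBC.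
- by rewrite opprB; apply: mxpow_opp_lip_le1_half => //; apply/loewnerB/loewner_opb.
Qed.

Lemma lip_gt0 r : 0 < r -> 0 < lip r.
Proof. by move=> r0; rewrite mulr_gt0 // Rpower_gt0. Qed.

(** Induction on an integer above [r], splitting off one factor of exponent -1: [Y^-r - Z^-r = Y^-1
    (Y^-(r-1) - Z^-(r-1)) + (Y^-1 - Z^-1) Z^-(r-1)]. The constants add up without loss, since [b^-1
    (r-1) b^-r + b^-2 b^-(r-1) = r b^-(r+1)]. *)
Lemma mxpow_opp_lip r Y Z c : 0 < r -> 0 < c ->
  ge_scalar Y -> ge_scalar Z -> opb (Y - Z) c ->
  opb (mxpow Y (- r) - mxpow Z (- r)) (lip r * c).
Proof.
move=> r0 c0 hY hZ hYZ.
have [N] : exists N : nat, r <= N.+1%:R.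
  exists (Num.bound r); rewrite ltW // (lt_le_trans (archi_boundP (ltW r0))) //.
  by rewrite ler_nat.
elim: N r r0 => [|N IH] r r0 rN.
  by apply: mxpow_opp_lip_le1 => //; rewrite ?r0 //; exact: ltW.
have [r1|r1] := leP r 1.
  by apply: mxpow_opp_lip_le1 => //; rewrite ?r0 //; exact: ltW.
have u0 : 0 < r - 1 by rewrite subr_gt0.
have uN : r - 1 <= N.+1%:R by rewrite lerBlDr natr1.
have h1 : opb (mxpow Y (- 1) - mxpow Z (- 1)) (lip 1 * c).
  by apply: mxpow_opp_lip_le1 => //; rewrite ?ltr01 ?lexx //; exact: ltW.
have h2 := IH _ u0 uN.
have b1 : opb (mxpow Y (- 1)) (Rpower b (- 1)) by apply: opb_mxpow_opp.
have b2 : opb (mxpow Z (- (r - 1))) (Rpower b (- (r - 1))).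
  by apply: opb_mxpow_opp => //; exact: ltW.
have p1 := ge_scalar_posdef hY; have p2 := ge_scalar_posdef hZ.
have -> : mxpow Y (- r) - mxpow Z (- r) =
  mxpow Y (- 1) *m (mxpow Y (- (r - 1)) - mxpow Z (- (r - 1)))
  + (mxpow Y (- 1) - mxpow Z (- 1)) *m mxpow Z (- (r - 1)).
  rewrite mulmxBr mulmxBl -!mxpowD // addrA subrK.
  by have -> : - 1 - (r - 1) = - r by lra.
have -> : lip r * c = Rpower b (- 1) * (lip (r - 1) * c)
                      + lip 1 * c * Rpower b (- (r - 1)).
  rewrite /lip; have -> : - (r - 1 + 1) = - (r - 1) - 1 by lra.
  have -> : - (1 + 1) = - 1 - 1 :> R by lra.
  have -> : - (r + 1) = - (r - 1) + (- 1 - 1) by lra.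
  have E (x y : R) : Rpower b (x + y) = Rpower b x * Rpower b y by apply: Rpower_plus.
  by rewrite !E; ring.
apply: opbD; apply: opbM => //; try exact: Rpower_gt0;
  by apply: mulr_gt0 => //; exact: lip_gt0.
Qed.
End PowerLipschitz.

(** * Weak limits and a fixed point theorem for matrices *)

Lemma Un_cv_sum (I : finType) (a : I -> nat -> R) (l : I -> R) :
  (forall i, Un_cv (a i) (l i)) -> Un_cv (fun m => \sum_i a i m) (\sum_i l i).
Proof.
move=> h; elim: (index_enum I) => [|i s IH].
  by rewrite big_nil; apply: Un_cv_ext (Un_cv_const 0) => m; rewrite big_nil.
rewrite big_cons; apply: Un_cv_ext (CV_plus _ _ _ _ (h i) IH) => m.
by rewrite big_cons.
Qed.

Section HermitianContraction.
Variable n : nat.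
Implicit Types (M Y Z : 'M[R[i]]_n) (u v : 'cV[R[i]]_n).

(** A fixed real linear combination of the real and imaginary parts of the entries of [M], through
    which entrywise limits pass. *)
Lemma rdot_mulmxE M u v : rdot u (M *m v) = \sum_i \sum_j
  (complex.Re (M i j) * (complex.Re (u i 0) * complex.Re (v j 0)
                         + complex.Im (u i 0) * complex.Im (v j 0))
   + complex.Im (M i j) * (complex.Im (u i 0) * complex.Re (v j 0)
                           - complex.Re (u i 0) * complex.Im (v j 0))).
Proof.
rewrite rdotE; apply: eq_bigr => i _; rewrite mxE.
rewrite (big_morph (@complex.Re R) (id1 := 0) (op1 := +%R)) //; last by case=> ? ? [].
rewrite (big_morph (@complex.Im R) (id1 := 0) (op1 := +%R)) //; last by case=> ? ? [].
rewrite !mulr_sumr -big_split; apply: eq_bigr => j _ /=.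
by case: (M i j); case: (v j 0) => a b c d /=; ring.
Qed.

Lemma rdot_delta M i j : rdot (delta_mx i 0) (M *m delta_mx j 0) = complex.Re (M i j).
Proof.
rewrite -colE rdotE (bigD1 i) //= big1 ?addr0 => [|k /negPf ki].
  by rewrite !mxE !eqxx /= mul1r mul0r addr0.
by rewrite !mxE ki /= !mul0r addr0.
Qed.

Lemma rdot_idelta M i j :
  rdot ('i%C *: delta_mx i 0) (M *m delta_mx j 0) = complex.Im (M i j).
Proof.
rewrite -colE rdotE (bigD1 i) //= big1 ?addr0 => [|k /negPf ki].
  by rewrite !mxE !eqxx mulr1 /= mul1r mul0r add0r.
by rewrite !mxE ki mulr0 /= !mul0r addr0.
Qed.

Lemma opb_exists M : M ^t* = M -> exists2 c, 0 < c & opb M c.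
Proof.
move=> hM; have [U [d [hU ME]]] := spec_mxP hM.
(* The sum dominates every [|d i|]; the [+ 1] makes [c] positive even for [M = 0]. *)
pose c := \sum_i `|d i| + 1.
have dc i : `|d i| <= c.
  rewrite /c (bigD1 i) //= -addrA lerDl addr_ge0 // sumr_ge0 // => j _.
exists c; first by rewrite ltr_wpDl // sumr_ge0.
apply: opb_loewner => //; rewrite ME -(spec_mx_const c hU).
  by apply: spec_mx_le => i; apply: le_trans (ler_norm _) (dc i).
move=> v; rewrite mulNmx rdotNr !spec_mx_rdot -sumrN; apply: ler_sum => i _.
rewrite -mulNr ler_wpM2r // ?addr_ge0 ?sqr_ge0 //.
by apply: le_trans (dc i); rewrite -normrN ler_norm.
Qed.

(** Equivalent to entrywise convergence in finite dimension; in this form Loewner inequalities and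
    [opb] bounds pass directly to the limit. *)
Definition weak_cv (Ys : nat -> 'M[R[i]]_n) Y :=
  forall u v, Un_cv (fun m => rdot u (Ys m *m v)) (rdot u (Y *m v)).

Lemma weak_cv_entries (Ys : nat -> 'M[R[i]]_n) :
  (forall u v, exists l, Un_cv (fun m => rdot u (Ys m *m v)) l) ->
  exists Y, weak_cv Ys Y.
Proof.
move=> h.
have hRe i j : exists l, Un_cv (fun m => complex.Re (Ys m i j)) l.
  have [l hl] := h (delta_mx i 0) (delta_mx j 0); exists l.
  by apply: Un_cv_ext hl => m; rewrite rdot_delta.
have hIm i j : exists l, Un_cv (fun m => complex.Im (Ys m i j)) l.
  have [l hl] := h ('i%C *: delta_mx i 0) (delta_mx j 0); exists l.
  by apply: Un_cv_ext hl => m; rewrite rdot_idelta.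
pose re i j := sval (constructive_indefinite_description _ (hRe i j)).
pose im i j := sval (constructive_indefinite_description _ (hIm i j)).
exists (\matrix_(i, j) (re i j +i* im i j)%C) => u v.
rewrite rdot_mulmxE; apply: Un_cv_ext.
  by move=> m; rewrite rdot_mulmxE.
apply: Un_cv_sum => i; apply: Un_cv_sum => j; rewrite !mxE /=.
apply: CV_plus; apply: CV_mult; try exact: Un_cv_const.
  exact: (svalP (constructive_indefinite_description _ (hRe i j))).
exact: (svalP (constructive_indefinite_description _ (hIm i j))).
Qed.

(** Banach's theorem for the iterates of [F] from [Y0], with [opb (Y - Z) c] in the place of a
    distance at most [c]. *)
Lemma contraction_fixed_point (P : 'M[R[i]]_n -> Prop) (F : 'M[R[i]]_n -> 'M[R[i]]_n)
    (k : R) (Y0 : 'M[R[i]]_n) :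
  0 < k < 1 -> P Y0 -> (forall Y, P Y -> Y ^t* = Y) -> (forall Y, P Y -> P (F Y)) ->
  (forall Ys Y, (forall m, P (Ys m)) -> weak_cv Ys Y -> P Y) ->
  (forall Y Z c, 0 < c -> P Y -> P Z -> opb (Y - Z) c -> opb (F Y - F Z) (k * c)) ->
  exists2 Y, P Y & F Y = Y.
Proof.
move=> /andP[k0 k1] P0 Pherm PF Pcl Fk.
pose Ys m := iter m F Y0.
have PY m : P (Ys m) by elim: m => //= m; apply: PF.
have [D D0 hD] : exists2 D, 0 < D & opb (F Y0 - Y0) D.
  by apply: opb_exists; rewrite linearB /= map_mxB !Pherm //; apply: PF.
have step m : opb (Ys m.+1 - Ys m) (k ^+ m * D).
  elim: m => [|m IH]; first by rewrite expr0 mul1r.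
  by rewrite exprS -mulrA; apply: Fk (PY _) (PY _) IH; rewrite mulr_gt0 // exprn_gt0.
have k1' : 0 < 1 - k by rewrite subr_gt0.
pose E := D / (1 - k).
have E0 : 0 < E by rewrite divr_gt0.
have tail m l : opb (Ys (m + l)%N - Ys m) (E * k ^+ m).
  (* The exact partial geometric sum, kept because the weaker bound [E k^m] is not inductive in
     [l]. *)
  have ex : opb (Ys (m + l)%N - Ys m) (E * k ^+ m * (1 - k ^+ l)).
    elim: l => [|l IH].
      rewrite addn0 subrr expr0 subrr mulr0 => u v.
      by rewrite mul0mx rdot0r mulr0 mul0r.
    have := opbD (step (m + l)%N) IH; rewrite -addnS addrA subrK.
    congr (opb _ _); rewrite exprD exprS /E.
    by field; rewrite gt_eqF.
  have kl : 0 <= k ^+ l by apply/exprn_ge0/ltW.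
  have km : 0 <= E * k ^+ m by apply: mulr_ge0; [exact: ltW | apply/exprn_ge0/ltW].
  by apply: opb_le ex; rewrite ler_piMr // gerBl.
have cauchy u v : exists l, Un_cv (fun m => rdot u (Ys m *m v)) l.
  have G0 : 0 < E * (rdot u u + rdot v v + 1).
    by rewrite mulr_gt0 // ltr_wpDl // addr_ge0 // rdot_ge0.
  have K1 : (Rlt 0 k /\ Rlt k 1) by split; apply/RltP.
  refine (@geometric_cv (fun m => rdot u (Ys m *m v)) k _ K1 (elimT RltP G0) _).
  move=> m l; apply/RleP; rewrite RabsE RpowE.
  rewrite -[X in `|X|]/(rdot u (Ys (m + l)%N *m v) - rdot u (Ys m *m v)).
  rewrite -rdotBr -mulmxBl.
  have h1 := tail m l u v; have h2 := opbN (tail m l) u v.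
  have km : 0 < E * k ^+ m by rewrite mulr_gt0 // exprn_gt0.
  rewrite mulNmx rdotNr in h2.
  rewrite -[X in _ <= X]/(E * (rdot u u + rdot v v + 1) * k ^+ m).
  have g0 : 0 <= rdot u u + rdot v v by rewrite addr_ge0 // rdot_ge0.
  rewrite ler_norml; move: h1 h2 km g0.
  move: (rdot u u + rdot v v) (rdot u _) => g x.
  rewrite [E * _ * _]mulrAC; move: (E * k ^+ m) => t h1 h2 km g0.
  by apply/andP; split; nra.
have [Y hY] := weak_cv_entries cauchy.
have PYl : P Y by exact: Pcl hY.
exists Y => //; have lim m : opb (Y - Ys m) (E * k ^+ m).
  move=> u v; rewrite mulmxBl rdotBr.
  have : rdot u (Y *m v) <= rdot u (Ys m *m v) + E * k ^+ m * (rdot u u + rdot v v) / 2.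
    apply/RleP; apply: (Un_cv_le_eventually _ _ _ m (hY u v)) => l /ssrnat.leP ml.
    apply/RleP; have := tail m (l - m)%N u v; rewrite subnKC // mulmxBl rdotBr.
    by rdot_lra.
  by rdot_lra.
apply/eqP; rewrite -subr_eq0; apply/eqP; apply: opb_eq0 => e e0.
(* [F Y - Y] is split at [Ys N.+1 = F (Ys N)]; each of the two pieces is bounded by [E k^N]. *)
have [N hN] : exists N : nat, 2 * E * k ^+ N < e.
  have K1 : (Rlt 0 k /\ Rlt k 1) by split; apply/RltP.
  have E2 : 0 < 2 * E by rewrite mulr_gt0.
  have [N /(_ N (le_n N)) hN] :=
    @geometric_lt k (2 * E) e K1 (elimT RltP E2) (elimT RltP e0).
  by exists N; apply/RltP; rewrite -RpowE.
have h1 : opb (F Y - F (Ys N)) (k * (E * k ^+ N)).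
  by apply: Fk => //; rewrite mulr_gt0 // exprn_gt0.
have h2 : opb (Ys N.+1 - Y) (E * k ^+ N.+1) by apply: opbBC; apply: lim.
have := opbD h1 h2; rewrite addrA subrK; apply: opb_le.
have t0 : 0 <= E * k ^+ N by apply: mulr_ge0; [exact: ltW | apply/exprn_ge0/ltW].
have : k * (E * k ^+ N) <= E * k ^+ N by apply: ler_piMl => //; exact: ltW.
by move: hN; rewrite -mulrA exprS (mulrCA E k); move: (E * _) => t; lra.
Qed.
End HermitianContraction.

(** * Solving the equation for [Y] *)

Lemma subr_addr_comm (V : zmodType) (q x y z t : V) :
  q - (x + y) - (q - (z + t)) = z - x + (t - y).
Proof. by rewrite opprB addrC subrKA opprD addrACA. Qed.

Section MatrixEquation.
Variable n : nat.
Implicit Types (A B M Q X Y Z : 'M[R[i]]_n).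

Lemma rdot_ext M Y : (forall u v, rdot u (M *m v) = rdot u (Y *m v)) -> M = Y.
Proof.
move=> h; apply/matrixP => i j; apply/eqP; rewrite eq_complex.
by rewrite -!rdot_delta -!rdot_idelta !h !eqxx.
Qed.

Lemma ge_scalar_weak_closed (b : R) (Ys : nat -> 'M[R[i]]_n) Y :
  (forall m, ge_scalar b (Ys m)) -> weak_cv Ys Y -> ge_scalar b Y.
Proof.
move=> h hY; split.
  apply: rdot_ext => u v; rewrite rdot_adj trmxCK rdotC.
  apply: UL_sequence (hY v u) _; apply: Un_cv_ext (hY u v) => m.
  by rewrite rdot_herm ?(proj1 (h m)) // rdotC.
(* The sign is changed because [Un_cv_le_eventually] bounds limits from above. *)
move=> v; rewrite -lerN2; apply/RleP.
apply: (Un_cv_le_eventually _ _ _ 0%N (CV_opp _ _ (hY v v))) => m _.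
by apply/RleP; rewrite /opp_seq RoppE lerN2; apply: (proj2 (h m)).
Qed.

Lemma rdot_conj A M v : rdot v (A ^t* *m M *m A *m v) = rdot (A *m v) (M *m (A *m v)).
Proof. by rewrite -!mulmxA rdot_adj trmxCK. Qed.

Lemma conj_herm A M : M ^t* = M -> (A ^t* *m M *m A) ^t* = A ^t* *m M *m A.
Proof. by move=> hM; rewrite !trmxC_mul hM trmxCK mulmxA. Qed.

Lemma real_scalar_mx_herm (c : R) : (c%:C%C%:M : 'M[R[i]]_n) ^t* = c%:C%C%:M.
Proof. by rewrite tr_scalar_mx map_scalar_mx; congr (_%:M); apply: conjc_real. Qed.

Lemma conj_mxB A M Y : A ^t* *m (M - Y) *m A = A ^t* *m M *m A - A ^t* *m Y *m A.
Proof. by rewrite mulmxBr mulmxBl. Qed.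

(** Here [k] is a lower bound of [Q], in the application its smallest eigenvalue, and [al], [be]
    bound squared norms. The equation for [b] gives the invariance of [ge_scalar b], and the slope
    condition gives the contraction. *)
Lemma matrix_equation_solution A B Q (b k al be r1 r2 : R) :
  0 < b -> 0 < r1 -> 0 < r2 -> 0 <= al -> 0 <= be ->
  Q ^t* = Q -> loewner_le k%:C%C%:M Q ->
  (forall v, rdot (A *m v) (A *m v) <= al * rdot v v) ->
  (forall v, rdot (B *m v) (B *m v) <= be * rdot v v) ->
  b = k - al * Rpower b (- r1) - be * Rpower b (- r2) ->
  al * (r1 * Rpower b (- (r1 + 1))) + be * (r2 * Rpower b (- (r2 + 1))) < 1 ->
  exists Y, [/\ ge_scalar b Y, loewner_le Y Q &
    Y + (A ^t* *m mxpow Y (- r1) *m A + B ^t* *m mxpow Y (- r2) *m B) = Q].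
Proof.
move=> b0 r10 r20 al0 be0 hQ kQ hA hB bE lt1.
pose F Y := Q - (A ^t* *m mxpow Y (- r1) *m A + B ^t* *m mxpow Y (- r2) *m B).
have FQ Y : loewner_le (F Y) Q.
  move=> v; rewrite /F mulmxBl mulmxDl rdotBr rdotDr !rdot_conj gerBl.
  have h1 := mxpow_ge0 Y (- r1) (A *m v); have h2 := mxpow_ge0 Y (- r2) (B *m v).
  by move: h1 h2; rewrite !mul0mx !rdot0r; apply: addr_ge0.
set kappa := _ + _ in lt1.
have ka0 : 0 <= kappa.
  by apply: addr_ge0; apply: mulr_ge0 => //; apply: mulr_ge0; apply: ltW => //;
     exact: Rpower_gt0.
have [Y PY FY] : exists2 Y, ge_scalar b Y & F Y = Y.
  (* [kappa] can be 0, namely for [al = be = 0], whereas the contraction constant must lie strictly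
     between 0 and 1; the midpoint of [kappa] and 1 does. *)
  apply: (@contraction_fixed_point _ (ge_scalar b) F ((kappa + 1) / 2) b%:C%C%:M).
  - by apply/andP; split; lra.
  - by split=> //; apply: real_scalar_mx_herm.
  - by move=> Y [].
  - move=> Y hY; split.
      by rewrite /F linearB linearD /= map_mxB map_mxD !conj_herm ?mxpow_herm // hQ.
    move=> v; rewrite /F mulmxBl mulmxDl rdotBr rdotDr !rdot_conj.
    have h1 := ge_scalar_mxpow_opp b0 (ltW r10) hY (A *m v).
    have h2 := ge_scalar_mxpow_opp b0 (ltW r20) hY (B *m v).
    have h3 := kQ v; move: h1 h2 h3; rewrite !mul_scalar_mx !rdotZr.
    have := ler_wpM2l (ltW (Rpower_gt0 b (- r1))) (hA v).
    have := ler_wpM2l (ltW (Rpower_gt0 b (- r2))) (hB v).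
    (* The fixed point equation identifies the lower bound obtained for [F Y] with [b]. *)
    have : b * rdot v v =
      (k - al * Rpower b (- r1) - be * Rpower b (- r2)) * rdot v v by rewrite -bE.
    move: (Rpower b (- r1)) (Rpower b (- r2)) => p1 p2; rdot_lra.
  - exact: ge_scalar_weak_closed.
  - move=> Y Z c c0 hY hZ hYZ.
    have -> : F Y - F Z = A ^t* *m (mxpow Z (- r1) - mxpow Y (- r1)) *m A
                          + B ^t* *m (mxpow Z (- r2) - mxpow Y (- r2)) *m B.
      by rewrite !conj_mxB; apply: subr_addr_comm.
    have h1 := mxpow_opp_lip b0 r10 c0 hZ hY (opbBC hYZ).
    have h2 := mxpow_opp_lip b0 r20 c0 hZ hY (opbBC hYZ).
    have l1 := lip_gt0 b r10; have l2 := lip_gt0 b r20.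
    apply: opb_le (opbD (opb_conj _ hA h1) (opb_conj _ hB h2)).
    + rewrite !mulrA -mulrDl ler_pM2r // -!mulrA -/kappa; lra.
    + by rewrite mulr_ge0 ?ltW.
    + by rewrite mulr_ge0 ?ltW.
exists Y; split=> //; first by rewrite -FY; apply: FQ.
by rewrite -{1}FY /F subrK.
Qed.
End MatrixEquation.

(** * Translation between index functions and library matrices *)

Section Translation.
Variable n : nat.
Implicit Types (A B M N X : Mat) (v w : Vec).

Definition toC (z : Defs.C) : R[i] := (re z +i* im z)%C.
Definition ofC (z : R[i]) : Defs.C := mkC (complex.Re z) (complex.Im z).
Definition toM A : 'M[R[i]]_n := \matrix_(i, j) toC (A i j).
Definition toV v : 'cV[R[i]]_n := \col_i toC (v i).
(** Indices from [n] on receive the default [C0]; [veq] and [meq] compare only those below [n]. *)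
Definition ofV (v : 'cV[R[i]]_n) : Vec :=
  fun i => if insub i is Some i' then ofC (v i' 0) else C0.
Definition ofM (M : 'M[R[i]]_n) : Mat :=
  fun i j => if insub j is Some j' then ofV (col j' M) i else C0.

Lemma ofCK z : toC (ofC z) = z.
Proof. by case: z. Qed.

Lemma toC_inj : injective toC.
Proof. by case=> a b [c d] [-> ->]. Qed.

Lemma toCD z t : toC (Cadd z t) = toC z + toC t.
Proof. by []. Qed.

Lemma toCM z t : toC (Cmul z t) = toC z * toC t.
Proof. by []. Qed.

Lemma toC_conj z : toC (Cconj z) = (toC z)^*.
Proof. by []. Qed.

Lemma toC_csum f m : toC (csum f m) = \sum_(i < m) toC (f i).
Proof.
elim: m => [|m IH] /=; first by rewrite big_ord0.
by rewrite big_ord_recr /= toCD IH.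
Qed.

Lemma ofVK (v : 'cV_n) : toV (ofV v) = v.
Proof. by apply/colP => i; rewrite mxE /ofV valK ofCK. Qed.

Lemma ofMK (M : 'M_n) : toM (ofM M) = M.
Proof. by apply/matrixP => i j; rewrite mxE /ofM valK /ofV valK ofCK mxE. Qed.

Lemma meqP A B : meq n A B <-> toM A = toM B.
Proof.
split=> [h|/matrixP h i j /ssrnat.ltP hi /ssrnat.ltP hj].
  by apply/matrixP => i j; rewrite !mxE h //; apply/ssrnat.ltP.
by have := h (Ordinal hi) (Ordinal hj); rewrite !mxE => /toC_inj.
Qed.

Lemma veqP v w : veq n v w <-> toV v = toV w.
Proof.
split=> [h|/colP h i /ssrnat.ltP hi].
  by apply/colP => i; rewrite !mxE h //; apply/ssrnat.ltP.
by have := h (Ordinal hi); rewrite !mxE => /toC_inj.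
Qed.

Lemma toM_mul A B : toM (mmul n A B) = toM A *m toM B.
Proof.
apply/matrixP => i j; rewrite !mxE toC_csum.
by apply: eq_bigr => l _; rewrite !mxE toCM.
Qed.

Lemma toM_add A B : toM (madd A B) = toM A + toM B.
Proof. by apply/matrixP => i j; rewrite !mxE toCD. Qed.

Lemma toM_sub A B : toM (msub A B) = toM A - toM B.
Proof.
apply/matrixP => i j; rewrite !mxE toCD toCM; congr (_ + _).
rewrite -mulN1r; congr (_ * _).
by apply/eqP; rewrite eq_complex /= oppr0 !eqxx.
Qed.

Lemma toM_adj A : toM (madj A) = (toM A) ^t*.
Proof. by apply/matrixP => i j; rewrite !mxE toC_conj. Qed.

Lemma toM_diag d : toM (mdiag d) = diag_mx (\row_i (d (nat_of_ord i))%:C%C).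
Proof.
apply/matrixP => i j; rewrite !mxE /mdiag.
have -> : Nat.eqb i j = (i == j) by apply/PeanoNat.Nat.eqb_spec/eqP => [/val_inj|->].
by case: eqP => // _; rewrite mulr1n.
Qed.

Lemma toM_scal c : toM (mscal c) = c%:C%C%:M.
Proof.
rewrite -diag_const_mx -[mscal c]/(mdiag (fun=> c)) toM_diag; congr diag_mx.
by apply/rowP => i; rewrite !mxE.
Qed.

Lemma toV_mul A v : toV (mvmul n A v) = toM A *m toV v.
Proof.
apply/colP => i; rewrite !mxE toC_csum.
by apply: eq_bigr => l _; rewrite !mxE toCM.
Qed.

Lemma re_inner v w : re (inner n v w) = rdot (toV v) (toV w).
Proof.
rewrite rdot.unlock -[LHS]/(complex.Re (toC (inner n v w))) toC_csum mxE.
by congr complex.Re; apply: eq_bigr => i _; rewrite !mxE toCM toC_conj.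
Qed.

Lemma vnonzeroP v : vnonzero n v <-> toV v != 0.
Proof.
split=> [[i [/ssrnat.ltP hi vi]]|/matrix0Pn [i [j]]].
  apply/eqP => /colP /(_ (Ordinal hi)); rewrite !mxE => v0.
  by apply: vi; apply: toC_inj; rewrite v0.
rewrite mxE => vi; exists i; split; first exact/ssrnat.ltP.
by move=> v0; rewrite v0 eqxx in vi.
Qed.

Lemma HermitianP M : Defs.Hermitian n M <-> (toM M) ^t* = toM M.
Proof. by rewrite -toM_adj; apply: meqP. Qed.

Lemma LleP M N : (toM M) ^t* = toM M -> (toM N) ^t* = toM N ->
  loewner_le (toM M) (toM N) -> Lle n M N.
Proof.
move=> hM hN MN; split.
  by apply/HermitianP; rewrite toM_sub linearB /= map_mxB hM hN.
move=> v; apply/RleP; rewrite re_inner toV_mul toM_sub mulmxBl rdotBr subr_ge0.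
exact: MN.
Qed.

Lemma toM_spec U d r : toM (mmul n (mmul n U (mdiag (fun i => Rpower (d i) r))) (madj U))
  = spec_mx (toM U) (fun i => Rpower (d (nat_of_ord i)) r).
Proof. by rewrite spec_mx.unlock !toM_mul toM_adj toM_diag. Qed.

(** Every diagonalization of [X] leads to the same power, so the [epsilon] in [mpow] is determined
    on indices below [n]. *)
Lemma PowRel_toM X r M : PowRel n X r M -> toM M = mxpow (toM X) r.
Proof.
move=> [U [d [hU [d0 [/meqP XE /meqP ->]]]]].
have uU : toM U \is unitarymx.
  (* [Unitary] states [U^* U = I] and [unitarymx] states [U U^* = I]; passing to the adjoint
     reconciles them. *)
  rewrite -trmxC_unitary; apply/unitarymxP; rewrite trmxCK -toM_adj -toM_mul.
  by rewrite (proj1 (meqP _ _) hU) toM_scal.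
have -> : toM X = spec_mx (toM U) (fun i => d (nat_of_ord i)).
  by rewrite XE spec_mx.unlock !toM_mul toM_adj toM_diag.
by rewrite mxpow_spec // toM_spec.
Qed.

Lemma PowRel_exists X r : posdef (toM X) -> exists M, PowRel n X r M.
Proof.
move=> [U [d [hU d0 XE]]]; exists (ofM (mxpow (toM X) r)).
pose d' i := if insub i is Some i' then d i' else 0.
have dE : d =1 (fun i => d' (nat_of_ord i)) by move=> i; rewrite /d' valK.
exists (ofM U), d'; split; [|split; [|split]].
- apply/meqP; rewrite toM_mul toM_adj ofMK unitarymxK //.
  by rewrite -[mid]/(mscal 1) toM_scal.
- by move=> i /ssrnat.ltP hi; rewrite /d' insubT; apply/RltP; apply: d0.
- apply/meqP; rewrite !toM_mul toM_adj toM_diag ofMK XE spec_mx.unlock.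
  by congr (_ *m diag_mx _ *m _); apply/rowP => i; rewrite !mxE dE.
- apply/meqP; rewrite toM_spec ofMK XE mxpow_spec //.
  by rewrite ofMK; apply: eq_spec_mx => i; rewrite dE.
Qed.

Lemma toM_mpow X r : posdef (toM X) -> toM (mpow n X r) = mxpow (toM X) r.
Proof.
by move=> hX; apply: PowRel_toM; apply: epsilon_spec; apply: PowRel_exists.
Qed.

Lemma PD_posdef M : PD n M -> posdef (toM M).
Proof.
move=> [/HermitianP hM pM]; have [U [d [hU ME]]] := spec_mxP hM.
exists U, d; split=> // i.
have /pM : vnonzero n (ofV (col i U)).
  apply/vnonzeroP; rewrite ofVK -rdot_eq0 rdot_col_unitary //; exact: oner_neq0.
rewrite re_inner toV_mul ofVK ME spec_mx_col // rdotZr rdot_col_unitary // mulr1.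
by move=> /RltP.
Qed.

Lemma ge_PD M (b : R) : 0 < b -> (toM M) ^t* = toM M ->
  loewner_le b%:C%C%:M (toM M) -> PD n M.
Proof.
move=> b0 hM bM; split; first exact/HermitianP.
move=> v /vnonzeroP v0; apply/RltP; rewrite re_inner toV_mul.
apply: lt_le_trans (bM _); rewrite mul_scalar_mx rdotZr mulr_gt0 //.
exact: rdot_gt0.
Qed.

Lemma eigval_toM M mu : eigval n M mu <->
  exists2 v : 'cV_n, v != 0 & toM M *m v = mu%:C%C *: v.
Proof.
have scaleE v : toV (fun i => Cmul (RtoC mu) (v i)) = mu%:C%C *: toV v.
  by apply/colP => i; rewrite !mxE toCM.
split=> [[v [/vnonzeroP v0 /veqP E]]|[v v0 E]].
  by exists (toV v) => //; rewrite -toV_mul E scaleE.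
exists (ofV v); split; first by apply/vnonzeroP; rewrite ofVK.
by apply/veqP; rewrite toV_mul scaleE ofVK.
Qed.

(** Each diagonal entry [d i] is an eigenvalue, with column [i] of [U] as eigenvector, so [mu] is
    below all of them. *)
Lemma is_lmin_le M (mu : R) : PD n M -> is_lmin n M mu ->
  0 < mu /\ loewner_le mu%:C%C%:M (toM M).
Proof.
move=> hM [/eigval_toM [v v0 vE] hmin]; split.
  have := proj2 hM (ofV v); rewrite re_inner toV_mul ofVK vE rdotZr.
  move=> h; have /h /RltP : vnonzero n (ofV v) by apply/vnonzeroP; rewrite ofVK.
  by rewrite pmulr_lgt0 // rdot_gt0.
have [U [d [hU d0 ME]]] := PD_posdef hM.
rewrite ME -(spec_mx_const _ hU); apply: spec_mx_le => i; apply/RleP; apply: hmin.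
apply/eigval_toM; exists (col i U); last by rewrite ME spec_mx_col.
by rewrite -rdot_eq0 rdot_col_unitary // oner_neq0.
Qed.

Lemma is_opnorm_le M (a : R) : is_opnorm n M a ->
  forall v : 'cV_n, rdot (toM M *m v) (toM M *m v) <= a ^+ 2 * rdot v v.
Proof.
move=> [ub _] v; have [->|v0] := eqVneq v 0; first by rewrite mulmx0 rdot0r mulr0.
have N0 := rdot_gt0 v0; set N := rdot v v in N0 *.
pose w := ((Num.sqrt N)^-1)%:C%C *: v.
have sN : Num.sqrt N ^+ 2 = N by rewrite sqr_sqrtr // ltW.
have w1 : rdot w w = 1.
  by rewrite /w !rdotZl !rdotZr mulrA -expr2 exprVn sN mulVf // gt_eqF.
have Mw : rdot (toM M *m w) (toM M *m w) = N^-1 * rdot (toM M *m v) (toM M *m v).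
  by rewrite /w -!scalemxAr !rdotZl !rdotZr mulrA -expr2 exprVn sN.
have : Rle (sqrt (vnorm2 n (mvmul n M (ofV w)))) a.
  apply: ub; exists (ofV w); split=> //.
  by rewrite /vnorm2 re_inner ofVK.
rewrite /vnorm2 re_inner toV_mul ofVK RsqrtE => /RleP.
move=> h; have : rdot (toM M *m w) (toM M *m w) <= a ^+ 2.
  rewrite -(sqr_sqrtr (rdot_ge0 _)) ler_sqr ?nnegrE ?sqrtr_ge0 //.
  exact: le_trans (sqrtr_ge0 _) h.
by rewrite Mw mulrC ler_pdivrMr.
Qed.
End Translation.

(* From [Y] to the solution [X] *)
Close Scope sesquilinear_scope.
Close Scope ring_scope.
#[local] Arguments Rpower (_ _)%_R_scope.
Local Open Scope R_scope.

Theorem mainTheorem5 (n : nat) (s t p : R) (A B Q : Mat) (k kt nA nB : R) :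
  1 <= s -> 1 <= t -> 1 <= p ->
  GL n A -> GL n B -> PD n Q ->
  is_lmax n Q k -> 1 < k -> is_lmin n Q kt ->
  is_opnorm n A nA -> is_opnorm n B nB ->
  let q := Rmin (t / s) (p / s) in
  let qt := Rmax (t / s) (p / s) in
  nA ^ 2 + nB ^ 2 <
    Rpower q qt * Rpower kt (qt + 1) / (Rpower k qt * Rpower (q + 1) (qt + 1)) ->
  exists X, PD n X /\
    meq n (madd (mpow n X s)
              (madd (mmul n (mmul n (madj A) (mpow n X (- t))) A)
                    (mmul n (mmul n (madj B) (mpow n X (- p))) B))) Q /\
    Lle n (mscal (Rpower (q * kt / (k * (q + 1))) (1 / s))) X /\
    Lle n X (mpow n Q (1 / s)).
Proof.
move=> s1 t1 p1 _ _ hQ [keig _] k1 hkt hA hB q qt hlt.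
have ktk : kt <= k by apply: (proj2 hkt).
have [/RltP kt0 ktQ] := is_lmin_le hQ hkt.
have pQ := PD_posdef hQ; have hermQ := posdef_herm pQ.
have s0 : 0 < s by exact: Rlt_le_trans Rlt_0_1 s1.
have sN0 : s <> 0 by exact: Rgt_not_eq.
have ts0 : 0 < t / s.
  by apply: Rdiv_lt_0_compat => //; exact: Rlt_le_trans Rlt_0_1 t1.
have ps0 : 0 < p / s.
  by apply: Rdiv_lt_0_compat => //; exact: Rlt_le_trans Rlt_0_1 p1.
have [a0 ga] := concave_start _ _ _ _ _ _ _ s1 t1 p1
  (pow2_ge_0 nA) (pow2_ge_0 nB) kt0 ktk k1 hlt.
set a := _ / _ in a0 ga.
have [b [ab [bE slope]]] := concave_fixed_point _ _ _ _ _ _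
  (pow2_ge_0 nA) (pow2_ge_0 nB) ts0 ps0 a0 ga.
have /RltP b0 : 0 < b by exact: Rlt_le_trans ab.
have [Y [hY YQ EY]] : exists Y, [/\ ge_scalar b Y, loewner_le Y (toM n Q) &
    (Y + ((toM n A ^t*)%sesqui *m mxpow Y (- (t / s)) *m toM n A
          + (toM n B ^t*)%sesqui *m mxpow Y (- (p / s)) *m toM n B) = toM n Q)%R].
  apply: (matrix_equation_solution b0 _ _ _ _ hermQ ktQ _ _ bE) => //.
  - exact/RltP.
  - exact/RltP.
  - by apply/RleP; apply: pow2_ge_0.
  - by apply/RleP; apply: pow2_ge_0.
  - by move=> v; rewrite RpowE; apply: is_opnorm_le.
  - by move=> v; rewrite RpowE; apply: is_opnorm_le.
  - exact/RltP.
have pY := ge_scalar_posdef b0 hY.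
have is0 : 0 <= 1 / s by apply: Rlt_le; apply: Rdiv_lt_0_compat => //; exact: Rlt_0_1.
have is1 : 1 / s <= 1.
  rewrite -[X in _ <= X]Rinv_1 /Rdiv Rmult_1_l.
  by apply: Rinv_le_contravar => //; exact: Rlt_0_1.
(* This choice turns [X^s], [X^-t], [X^-p] into [Y], [Y^-(t/s)], [Y^-(p/s)]. *)
pose X := ofM (mxpow Y (1 / s)).
have XE : toM n X = mxpow Y (1 / s) by rewrite /X ofMK.
have hX : ((toM n X ^t*)%sesqui = toM n X)%R by rewrite XE mxpow_herm.
have pX : posdef (toM n X) by rewrite XE; exact: mxpow_posdef.
have powX r u : 1 / s * r = u -> toM n (mpow n X r) = mxpow Y u.
  by move=> <-; rewrite toM_mpow // XE mxpowM.
(* [Y >= b I] gives [X >= b^(1/s) I] on the spectrum, and [b >= a]. *)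
have bX : loewner_le (real_complex R (Rpower a (1 / s)))%:M%R (toM n X).
  rewrite XE => v; apply: le_trans (ge_scalar_mxpow b0 _ hY v); last exact/RleP.
  rewrite !mul_scalar_mx !rdotZr ler_wpM2r ?rdot_ge0 //; apply/RleP.
  by apply: Rle_Rpower_l.
exists X; split; [|split; [|split]].
- by apply: ge_PD hX bX; exact: Rpower_gt0.
- have divN r : 1 / s * - r = - (r / s).
    by rewrite /Rdiv Rmult_1_l Rmult_comm Ropp_mult_distr_l.
  have divs : 1 / s * s = 1 by rewrite /Rdiv Rmult_1_l Rinv_l.
  apply/meqP; rewrite !toM_add !toM_mul !toM_adj.
  rewrite (powX s 1) ?(powX (- t) (- (t / s))) ?(powX (- p) (- (p / s))) //.
  by rewrite mxpow1.
- by apply: LleP; rewrite ?toM_scal ?real_scalar_mx_herm.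
- apply: LleP => //; rewrite toM_mpow // ?mxpow_herm // XE.
  by apply: loewner_heinz => //; apply/andP; split; exact/RleP.
Qed.
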